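(* For each real $\epsilon > 0$ there exist $\Delta_0 \in \mathbb{N}$ and a function $r \colon \mathbb{N} \to \mathbb{R}$ with $r(\Delta) \to 0$ as $\Delta \to \infty$ (both depending only on $\epsilon$) such that the following holds. Let $\Delta \geq \Delta_0$ be an integer, let $G$ be an $n$-vertex triangle-free graph of maximum degree at most $\Delta$, and let $q$ be an integer with $q \geq (1+\epsilon)\Delta/\log\Delta$. Then $$c(G,q) \,\geq\, \exp\left(\left(1 + \frac{\epsilon}{1+\epsilon} - r(\Delta)\right)\frac{\log\Delta}{2}\, n\right).$$
   Context: All graphs are finite, undirected, and simple; $\log$ is the natural logarithm. For a graph $G$ and a positive integer $q$, $c(G,q)$ denotes the number of proper $q$-colorings of $G$, i.e., of maps $f \colon V(G) \to \{1,\ldots,q\}$ with $f(u)\neq f(v)$ whenever $uv \in E(G)$. *)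

(* Defs.v *)
From mathcomp Require Import all_boot.

Set Implicit Arguments.
Unset Strict Implicit.
Unset Printing Implicit Defensive.

Record sgraph := SGraph {
  vertex :> finType;
  adj : rel vertex;
  adj_sym : symmetric adj;
  adj_irrefl : irreflexive adj
}.

Definition max_degree (G : sgraph) : nat :=
  \max_(v : G) #|[set u : G | adj v u]%SET|.

Definition triangle_free (G : sgraph) : Prop :=
  forall u v w : G, ~ [/\ adj u v, adj v w & adj u w].

Definition proper_coloring (G : sgraph) (q : nat) (f : {ffun G -> 'I_q}) : bool :=
  [forall u : G, forall v : G, adj u v ==> (f u != f v)].

Definition num_colorings (G : sgraph) (q : nat) : nat :=
  #|[set f : {ffun G -> 'I_q} | proper_coloring f]%SET|.

(* Main.v *)
Require Import Defs.
From mathcomp Require Import all_classical all_reals all_analysis.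
From mathcomp Require Import all_boot all_order all_algebra.
From mathcomp Require Import ring lra.
Set Implicit Arguments.
Unset Strict Implicit.
Unset Printing Implicit Defensive.
Import Order.TTheory GRing.Theory Num.Theory.
Import numFieldNormedType.Exports.
Local Open Scope ring_scope.

(** The proof counts colorings by adding the vertices one at a time.  For a set
U of vertices let p(U) be the probability that a uniformly random map from the
vertices to the q colors is proper on U.  The heart is the one-vertex bound

    p(v |: W) >= (1/2) exp(- kappa d / q) p(W),   d = number of neighbors of v in W,

where kappa = 1 + 1/lam is close to 1 ([card_extend]).  Multiplying it over all
vertices, the degrees d add up to the number of edges, at most Delta |G| / 2,
whence c(G,q) >= ((q/2) exp(- kappa Delta / (2q)))^|G| ([num_colorings_ge]).
With lam = ln Delta and q >= (1 + eps) Delta / ln Delta the base of this power is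
at least

    exp ((1 + eps/(1+eps)) (ln Delta)/2 - O(ln ln Delta)),

which is the claim ([per_vertex_ge]).

The one-vertex bound is Rosenfeld's counting method, in the form that Martinsson
gave it for the Johansson-Molloy theorem; it goes by induction on W.  Take a
uniform map f that is proper on W, and resample f on v and on the neighbors N of
v in W, all other values being kept.  As the graph is triangle-free, N is
independent, so each u in N receives a uniform color from its own list L(u) of
colors missing around u, independently of the others, and the color of v is
uniform ([card_fiber], [card_fiber_setU1]).  The conditional probability that v
gets a color missing on N is thus the average over the colors c of the product
over u of 1 - [c in L(u)]/|L(u)|.  If all lists are longer than 1 + lam, each
factor is at least exp(- kappa [c in L(u)]/|L(u)|); the exponents sum to
kappa d over all c, so convexity gives the bound exp(- kappa d / q).  A short
list lowers this bound by at most a fraction (1 + A)/q, with A = kappa d / q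
([sum_prod_avail_ge]).

It remains to see that short lists are rare.  A map that is proper on W and for
which u has a list of size at most t arises from one that is proper on W :\ u by
picking f(u) among at most t of the q colors ([card_small_avail]).  So the
probability of a short list at u is at most (t/q) p(W :\ u)/p(W), and by the
induction hypothesis p(W :\ u)/p(W) <= 2 exp(kappa Delta / q).  This is
at most Delta^(1/(1+eps) + o(1)), while q is at least Delta^(1 - o(1)); the expected number of
short lists around v is therefore so much smaller than q that they cost at most
a factor 2 ([slack_ok]). *)

(** * Summation over fibers *)

Lemma ler_sum_fibers (R : numDomainType) (I J : finType) (rho : I -> J)
    (A : {set I}) (F H : I -> R) :
  (forall i0, i0 \in A ->
     \sum_(i in A | rho i == rho i0) F i <= \sum_(i in A | rho i == rho i0) H i) ->
  \sum_(i in A) F i <= \sum_(i in A) H i.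
Proof.
move=> le_fib; rewrite (partition_big rho predT) // [leRHS](partition_big rho predT) //.
apply: ler_sum => j _.
case: (pickP [pred i | (i \in A) && (rho i == j)]) => [i0 /andP[Ai0 /eqP<-]|none].
  exact: le_fib.
by rewrite !big_pred0.
Qed.

(** * Colors missing on an independent neighborhood *)

Section LocalInequality.
Local Open Scope set_scope.
Variables (R : realType) (lam : R).
Hypothesis lam_gt0 : 0 < lam.
Let kappa := 1 + lam^-1.

(** After inverting both sides this is 1 / (1 - 1/x) <= 1 + kappa / x, so kappa has
to exceed 1; how little is decided by how far x is above 1. *)
Lemma expR_le_one_sub_inv (x : R) : 1 + lam < x -> expR (- (kappa / x)) <= 1 - x^-1.
Proof.
move=> lx; have x0 : 0 < x by move: lam_gt0 lx; lra.
have xl : 0 < 1 - x^-1.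
  by rewrite subr_gt0 invf_lt1 //; move: lam_gt0 lx; lra.
rewrite expRN -[leRHS]invrK lef_pV2 ?posrE ?expR_gt0 ?invr_gt0 //.
apply: le_trans (expR_ge1Dx _).
rewrite -[leLHS]mul1r ler_pdivrMr //.
have -> : (1 + kappa / x) * (1 - x^-1) = 1 + (lam^-1 * (x - 1 - lam)) / x ^+ 2.
  by rewrite /kappa; field; rewrite !gt_eqF.
rewrite lerDl mulr_ge0 ?invr_ge0 ?exprn_ge0 ?(ltW x0) //.
by rewrite mulr_ge0 ?invr_ge0 ?(ltW lam_gt0) //; move: lx; lra.
Qed.

Lemma prod_one_sub_ge (I : finType) (P : pred I) (w : I -> R) :
  (forall i, P i -> 0 <= w i <= 1) ->
  1 - \sum_(i | P i) w i <= \prod_(i | P i) (1 - w i) <= 1.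
Proof.
move=> w01; have : 1 - \sum_(i | P i) w i <= \prod_(i | P i) (1 - w i) /\
   0 <= \prod_(i | P i) (1 - w i) <= 1; last by case=> -> /andP[].
elim/big_rec2: _ => [|i b a Pi [ab b01]]; first by split; lra.
by have := w01 i Pi; move: ab b01 => ab /andP[b0 b1] /andP[w0 w1]; split; nra.
Qed.

(** The sum is q times the probability that a uniform color c is missed by all
u in N, each of them choosing uniformly from its list L u.  The short lists enter
only through the union bound [prod_one_sub_ge], the long ones through
[expR_le_one_sub_inv].  Jensen's inequality is used in the form of the tangent to
exp at - A: this keeps the bound linear in the number of short lists, so that
later only its expectation is needed. *)
Lemma sum_prod_avail_ge (T : finType) (q : nat) (N : {set T})
    (L : T -> {set 'I_q}) (A := kappa * #|N|%:R / q%:R) :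
  (0 < q)%N -> (forall u, u \in N -> L u != set0) ->
  expR (- A) * (q%:R - #|[set u in N | #|L u|%:R <= 1 + lam]|%:R * (1 + A)) <=
  \sum_(c : 'I_q) \prod_(u in N) (#|L u :\ c|%:R / #|L u|%:R).
Proof.
move=> q0 L0.
have kappa0 : 0 < kappa by rewrite addr_gt0 ?invr_gt0.
have A0 : 0 <= A by rewrite !mulr_ge0 ?invr_ge0 ?(ltW kappa0).
(* w u c is the probability that u takes the color c *)
pose w u c : R := (c \in L u)%:R / #|L u|%:R.
have cardL u : u \in N -> 1 <= #|L u|%:R :> R.
  by move=> /L0; rewrite -card_gt0 ler1n.
have w01 u c : u \in N -> 0 <= w u c <= 1.
  move=> uN; have L1 := cardL u uN; rewrite mulr_ge0 ?invr_ge0 //=.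
  rewrite ler_pdivrMr ?mul1r ?(lt_le_trans _ L1) //.
  by apply: le_trans L1; case: (c \in _).
have termE u c : u \in N -> #|L u :\ c|%:R / #|L u|%:R = 1 - w u c.
  move=> uN; have L1 := cardL u uN.
  have Lneq0 : #|L u|%:R != 0 :> R by rewrite gt_eqF // (lt_le_trans _ L1).
  rewrite /w -[X in X - _](divff Lneq0) -mulrBl; congr (_ / _).
  by rewrite (cardsD1 c (L u)) natrD addrAC subrr add0r.
have sumw u : u \in N -> \sum_c w u c = 1.
  move=> uN; rewrite -mulr_suml -natr_sum -big_mkcond sum1_card divff //.
  by rewrite gt_eqF // (lt_le_trans _ (cardL u uN)).
pose small u := #|L u|%:R <= 1 + lam.
pose s c := \sum_(u in N | small u) w u c.
pose y c := kappa * \sum_(u in N | ~~ small u) w u c.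
have y0 c : 0 <= y c.
  rewrite mulr_ge0 ?(ltW kappa0) ?sumr_ge0 // => u /andP[uN _].
  by case/andP: (w01 u c uN).
have term_ge c : expR (- A) * ((1 - s c) * (1 + A) - y c) <=
    \prod_(u in N) (#|L u :\ c|%:R / #|L u|%:R).
  rewrite (bigID small) /=.
  rewrite (eq_bigr (fun u => 1 - w u c)) => [|u /andP[uN _]]; last exact: termE.
  have /andP[Ps P1] : 1 - s c <= \prod_(u in N | small u) (1 - w u c) <= 1.
    by apply: prod_one_sub_ge => u /andP[uN _]; apply: w01.
  set P := \prod_(u in N | small u) _ in Ps P1 *.
  have P0 : 0 <= P.
    by apply: prodr_ge0 => u /andP[uN _]; case/andP: (w01 u c uN); lra.
  apply: (@le_trans _ _ (P * expR (- y c))); last first.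
    rewrite ler_wpM2l // /y mulr_sumr -sumrN expR_sum.
    apply: ler_prod => u /andP[uN big]; rewrite expR_ge0 /= termE //.
    rewrite /w; case: (c \in L u); last by rewrite mul0r mulr0 oppr0 expR0 addr0.
    by rewrite mul1r expR_le_one_sub_inv // ltNge.
  have tangent : expR (- A) * (1 + A - y c) <= expR (- y c).
    have -> : expR (- y c) = expR (- A) * expR (A - y c).
      by rewrite -expRD addrA addNr add0r.
    by rewrite ler_wpM2l ?expR_ge0 // -addrA expR_ge1Dx.
  apply: le_trans (ler_wpM2l P0 tangent); rewrite mulrCA ler_wpM2l ?expR_ge0 //.
  rewrite mulrBr lerB ?ler_wpM2r ?addr_ge0 //.
  by rewrite -[leRHS]mul1r ler_wpM2r.
apply: le_trans (ler_sum _ (fun c _ => term_ge c)).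
rewrite -mulr_sumr ler_wpM2l ?expR_ge0 // sumrB -mulr_suml sumrB.
have swap (Q : pred T) :
    \sum_c \sum_(u in N | Q u) w u c = \sum_(u in N | Q u) (1 : R).
  by rewrite exchange_big /=; apply: eq_bigr => u /andP[uN _]; apply: sumw.
rewrite sumr_const card_ord /s /y -mulr_sumr !swap.
have -> : \sum_(u in N | small u) (1 : R) = #|[set u in N | small u]|%:R.
  by rewrite -sum1_card natr_sum; apply: eq_bigl => u; rewrite inE.
have large_le : \sum_(u in N | ~~ small u) (1 : R) <= #|N|%:R.
  by rewrite -sum1_card natr_sum [leRHS](bigID small) /= lerDr sumr_ge0.
have := ler_wpM2l (ltW kappa0) large_le.
have -> : kappa * #|N|%:R = q%:R * A by rewrite /A [RHS]mulrC divfK // pnatr_eq0 -lt0n.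
by rewrite -[_ *+ _]/(q%:R) /small; nra.
Qed.

End LocalInequality.

(** * Resampling a proper coloring *)

Section Colorings.
Local Open Scope set_scope.
Variables (G : sgraph) (q : nat).
Implicit Types (U W N X : {set G}) (f g : {ffun G -> 'I_q}) (u v : G).

Definition proper_on U f : bool :=
  [forall u in U, forall v in U, adj u v ==> (f u != f v)].

(** The values outside U are arbitrary: all these sets live in one space, and
#|colorings U| is q ^ #|G| times the probability that a uniform map is proper
on U. *)
Definition colorings U := [set f | proper_on U f].

Lemma mem_colorings U f : (f \in colorings U) = proper_on U f.
Proof. by rewrite in_set. Qed.

Definition nbrs U v := [set u in U | adj v u].

Definition avail U f v := ~: (f @: nbrs U v).

(** Two maps have the same image under [erase X] exactly when they differ only by
resampling on X; the fibers of [erase X] are the classes over which the counts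
are averaged. *)
Definition erase X f : {ffun G -> option 'I_q} :=
  [ffun x => if x \in X then None else Some (f x)].

(** The maps obtained from f by letting v range over a, each u in N over L u, and
keeping the other values form a product set, counted by [card_box]. *)
Definition box v (a : {set 'I_q}) N (L : G -> {set 'I_q}) f (x : G) : pred 'I_q :=
  mem (if x == v then a else if x \in N then L x else [set f x]).

Lemma proper_onP U f :
  reflect (forall u v, u \in U -> v \in U -> adj u v -> f u != f v) (proper_on U f).
Proof.
apply: (iffP forall_inP) => [H u v uU vU uv|H u uU].
  by have /forall_inP/(_ v vU)/implyP := H u uU; apply.
by apply/forall_inP => v vU; apply/implyP; apply: H.
Qed.

Lemma availP U f v c :
  reflect (forall u, u \in U -> adj v u -> f u != c) (c \in avail U f v).
Proof.
rewrite inE; apply: (iffP idP) => [nin u uU vu|H].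
  by apply: contra nin => /eqP <-; apply: imset_f; rewrite inE uU.
by apply/imsetP => -[u]; rewrite inE => /andP[uU vu] cE; have := H u uU vu; rewrite cE eqxx.
Qed.

Lemma avail_setU1 W f v : avail (v |: W) f v = avail W f v.
Proof.
rewrite /avail (_ : nbrs _ v = nbrs W v) //; apply/setP => u; rewrite !inE.
by have [->|] //= := eqVneq u v; rewrite adj_irrefl andbF.
Qed.

Lemma proper_on_setU1 W f v :
  proper_on (v |: W) f = proper_on W f && (f v \in avail W f v).
Proof.
apply/proper_onP/andP => [H|[/proper_onP H /availP Hv] u w].
  split; first by apply/proper_onP => u w uW wW; apply: H; rewrite inE ?uW ?wW orbT.
  by apply/availP => u uW vu; rewrite eq_sym; apply: H; rewrite // !inE ?eqxx ?uW ?orbT.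
rewrite !inE => /orP[/eqP->|uW] /orP[/eqP->|wW].
- by rewrite adj_irrefl.
- by move=> vw; rewrite eq_sym; apply: Hv.
- by rewrite adj_sym => vu; apply: Hv.
- exact: H.
Qed.

Lemma erase_eqP X f g :
  reflect (forall x, x \notin X -> f x = g x) (erase X f == erase X g).
Proof.
apply: (iffP eqP) => [/ffunP H x xX|H].
  by have := H x; rewrite !ffunE (negPf xX) => -[].
by apply/ffunP => x; rewrite !ffunE; case: ifPn => // xX; rewrite H.
Qed.

Lemma card_box v (a : {set 'I_q}) N (L : G -> {set 'I_q}) f : v \notin N ->
  #|family (box v a N L f)| = (#|a| * \prod_(u in N) #|L u|)%N.
Proof.
move=> vN; rewrite card_family foldrE big_image /= /box (bigD1 v) //= eqxx.
congr (_ * _)%N; rewrite [RHS]big_mkcond /= [RHS](bigD1 v) //= (negPf vN) mul1n.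
by apply: eq_bigr => x /negPf->; case: ifP => // _; rewrite cards1.
Qed.

Lemma in_box v (a : {set 'I_q}) N (L : G -> {set 'I_q}) f g : v \notin N ->
  reflect [/\ g v \in a, forall u, u \in N -> g u \in L u
            & erase (v |: N) g = erase (v |: N) f]
          (g \in family (box v a N L f)).
Proof.
move=> vN; apply: (iffP familyP) => [H|[gv gN /eqP/erase_eqP gf] x].
  split; first by have := H v; rewrite /box inE eqxx.
    move=> u uN; have := H u; rewrite /box inE uN ifN //.
    by apply: contraNneq vN => <-.
  apply/eqP/erase_eqP => x; rewrite !inE negb_or => /andP[xv xN].
  by have := H x; rewrite /box inE (negPf xv) (negPf xN) !inE => /eqP.
rewrite /box; have [->|xv] := eqVneq x v; first by [].
case: ifPn => xN; first exact: gN.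
by rewrite inE gf // !inE negb_or xv.
Qed.

(** The list of u does not see the resampled vertices. *)
Lemma avail_resample W v N f g u : v \notin W -> [disjoint N & nbrs W u] ->
  erase (v |: N) g = erase (v |: N) f -> avail W g u = avail W f u.
Proof.
move=> vW dis /eqP/erase_eqP E; congr (~: _); apply: eq_in_imset => x xu.
apply: E; rewrite !inE negb_or (disjointFl dis xu) andbT.
by apply: contraNneq vW => <-; move: xu; rewrite inE => /andP[].
Qed.

Hypothesis triG : triangle_free G.

(** A common element of the two neighborhoods would close a triangle with v and u. *)
Lemma nbrs_disjoint W v u : u \in nbrs W v -> [disjoint nbrs W v & nbrs W u].
Proof.
rewrite inE => /andP[_ vu]; rewrite disjoint_subset; apply/subsetP => x.
rewrite !inE => /andP[_ vx]; apply/negP => /andP[_ ux].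
by apply: (triG (u := v) (v := u) (w := x)).
Qed.

Lemma notin_nbrs W v : v \notin W -> v \notin nbrs W v.
Proof. by rewrite inE => /negPf->. Qed.

(** This is where triangle-freeness acts: the neighbors of v in W are pairwise
non-adjacent, so the constraints on them only involve the values that are kept,
and the class of f0 is a product of lists. *)
Lemma fiber_box W v f0 : v \notin W -> f0 \in colorings W ->
  let N := nbrs W v in
  [set f in colorings W | erase (v |: N) f == erase (v |: N) f0] =i
  family (box v setT N (avail W f0) f0).
Proof.
move=> vW; rewrite inE => /proper_onP f0W N f; rewrite !inE.
apply/andP/(in_box _ _ _ _ (notin_nbrs vW)) => [[fW /eqP E]|[_ fN E]]; split=> //.
- by rewrite inE.
- move=> u uN; rewrite -(avail_resample vW (nbrs_disjoint uN) E).
  have uW : u \in W by move: uN; rewrite inE => /andP[].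
  by have := fW; rewrite -[W](setD1K uW) proper_on_setU1 avail_setU1 => /andP[].
2: exact/eqP.
have off x : x \in W -> x \notin N -> f x = f0 x.
  move=> xW xN; move/eqP/erase_eqP: E; apply; rewrite in_setU1 negb_or xN andbT.
  by apply: contraNneq vW => <-.
have fav u w : u \in N -> w \in W -> adj u w -> f u != f w.
  move=> uN wW uw; have wN : w \notin N.
    have := nbrs_disjoint uN; rewrite disjoint_sym => /disjointFr->//.
    by rewrite inE wW.
  by rewrite (off w wW wN) eq_sym; have /availP := fN u uN; apply.
apply/proper_onP => u w uW wW uw.
have [uN|uN] := boolP (u \in N); first exact: fav.
have [wN|wN] := boolP (w \in N); first by rewrite eq_sym fav // adj_sym.
by rewrite !off // f0W.
Qed.

Lemma card_fiber W v f0 : v \notin W -> f0 \in colorings W ->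
  let N := nbrs W v in
  #|[set f in colorings W | erase (v |: N) f == erase (v |: N) f0]|
  = (q * \prod_(u in N) #|avail W f0 u|)%N.
Proof.
move=> vW f0W N; rewrite (eq_card (fiber_box vW f0W)) card_box ?notin_nbrs //.
by rewrite cardsT card_ord.
Qed.

(** The summand c counts the colorings that give the color c to v. *)
Lemma card_fiber_setU1 W v f0 : v \notin W -> f0 \in colorings W ->
  let N := nbrs W v in
  #|[set f in colorings (v |: W) | erase (v |: N) f == erase (v |: N) f0]|
  = (\sum_(c : 'I_q) \prod_(u in N) #|avail W f0 u :\ c|)%N.
Proof.
move=> vW f0W N; rewrite -sum1_card (partition_big (fun f => f v) predT) //=.
apply: eq_bigr => c _; rewrite sum1_card.
transitivity #|family (box v [set c] N (fun u => avail W f0 u :\ c) f0)|.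
  2: by rewrite card_box ?notin_nbrs // cards1 mul1n.
apply: eq_card => f; rewrite -[LHS]/((f \in [set _ in _ | _]) && (f v == c)).
have fib : proper_on W f && (erase (v |: N) f == erase (v |: N) f0)
    = (f \in family (box v setT N (avail W f0) f0)).
  by rewrite -(fiber_box vW f0W) in_set mem_colorings.
rewrite in_set mem_colorings proper_on_setU1.
rewrite [X in X && (f v == c)]andbAC fib; have vN := notin_nbrs vW.
apply/andP/(in_box _ _ _ _ vN) => [[/andP[/(in_box _ _ _ _ vN)[_ fN E]]]|].
  move=> /availP fv /eqP fc; split=> // [|u uN]; first by rewrite inE fc.
  rewrite in_setD1 fN // andbT -fc; move: uN; rewrite inE => /andP[].
  exact: fv.
rewrite inE => -[fc fN E]; split=> //; apply/andP; split.
  apply/(in_box _ _ _ _ vN); split=> // [|u uN]; first by rewrite inE.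
  by have := fN u uN; rewrite inE => /andP[].
apply/availP => u uW vu; rewrite (eqP fc).
have /fN : u \in N by rewrite inE uW.
by rewrite in_setD1 => /andP[].
Qed.

(** The analogue of [fiber_box] for resampling u alone, with the neighborhood of u
kept; the color of u is restricted to a. *)
Lemma fiber_box1 W u f0 (a : {set 'I_q}) : u \notin W -> f0 \in colorings W ->
  [set f in colorings W | (erase (u |: set0) f == erase (u |: set0) f0)
     & f u \in a] =i family (box u a set0 (fun=> set0) f0).
Proof.
move=> uW; rewrite inE => /proper_onP f0W f.
have u0 : u \notin set0 by rewrite inE.
rewrite in_set mem_colorings.
apply/andP/(in_box _ _ _ _ u0) => [[fW /andP[/eqP E fu]]|[fu _ E]].
  by split=> // x; rewrite inE.
rewrite fu E eqxx; split=> //; apply/proper_onP => x y xW yW xy.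
have off z : z \in W -> f z = f0 z.
  move=> zW; move/eqP/erase_eqP: E; apply; rewrite !inE orbF.
  by apply: contraNneq uW => <-.
by rewrite !off // f0W.
Qed.

(** The list of u is determined by the values at the other vertices; given these, at
most t of the q colors of u are admissible when the list has at most t elements. *)
Lemma card_small_avail (R : realFieldType) W u (t : R) : u \notin W -> 0 <= t ->
  q%:R * #|[set f in colorings (u |: W) | #|avail W f u|%:R <= t]|%:R
    <= t * #|colorings W|%:R.
Proof.
move=> uW t0; rewrite -!sum1_card !natr_sum !mulr_sumr.
rewrite (eq_bigl (fun f => (f \in colorings W) &&
    ((f u \in avail W f u) && (#|avail W f u|%:R <= t)))); last first.
  by move=> f; rewrite in_set !mem_colorings proper_on_setU1 andbA.
rewrite big_mkcondr /=; apply: (ler_sum_fibers (rho := erase (u |: set0))) => f0 f0W.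
have avE f : erase (u |: set0) f == erase (u |: set0) f0 ->
    avail W f u = avail W f0 u.
  move=> /eqP; apply: avail_resample => //.
  by rewrite disjoint_subset; apply/subsetP => x; rewrite inE.
have fib (a : {set 'I_q}) : \sum_(f in colorings W | (erase (u |: set0) f == erase (u |: set0) f0)
     && (f u \in a)) (1 : R) = #|a|%:R.
  transitivity (#|family (box u a set0 (fun=> set0) f0)|%:R : R).
    rewrite -sum1_card natr_sum; apply: eq_bigl => f.
    by rewrite -(fiber_box1 _ uW f0W) [RHS]in_set.
  by rewrite card_box ?inE // big_set0 muln1.
have [small|big] := boolP (#|avail W f0 u|%:R <= t); last first.
  rewrite big1 ?sumr_ge0 // => [f _|f /andP[_ /avE->]]; first by rewrite mulr1.
  by rewrite (negPf big) andbF.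
rewrite -big_mkcondr -!mulr_sumr.
under eq_bigl => f do rewrite -andbA.
rewrite (eq_bigl (fun f => (f \in colorings W) &&
    ((erase (u |: set0) f == erase (u |: set0) f0) && (f u \in avail W f0 u)))); last first.
  move=> f; case: eqP => [E|]; rewrite ?andbF //=.
  by rewrite avE ?E // small andbT.
rewrite fib; have := fib setT; rewrite cardsT card_ord.
under eq_bigl => f do rewrite in_setT andbT.
move->; rewrite [leRHS]mulrC ler_wpM2l //.
Qed.

(** * Adding one vertex *)

Variables (R : realType) (Delta : nat) (lam : R).
Hypotheses (degG : (max_degree G <= Delta)%N).
Hypotheses (q_gt0 : (0 < q)%N) (lam_gt0 : 0 < lam).
Let kappa := 1 + lam^-1.
Let B := kappa * Delta%:R / q%:R.
(** It makes the total cost (1 + A) d (1 + lam) 2 exp(B) / q^2 of the short lists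
around a vertex of degree d at most 1/2, since A <= B and d <= Delta. *)
Hypothesis slack : 4 * (1 + B) * Delta%:R * (1 + lam) * expR B <= q%:R ^+ 2.

Let A W v := kappa * #|nbrs W v|%:R / q%:R.
Let few W v f := #|[set u in nbrs W v | #|avail W f u|%:R <= 1 + lam]|.

Let kappa_gt0 : 0 < kappa.
Proof. by rewrite addr_gt0 ?invr_gt0. Qed.

Let qR_gt0 : 0 < q%:R :> R.
Proof. by rewrite ltr0n. Qed.

Lemma card_nbrs_le W v : (#|nbrs W v| <= Delta)%N.
Proof.
apply: leq_trans degG; apply: leq_trans (leq_bigmax v); apply: subset_leq_card.
by apply/subsetP => u; rewrite !inE => /andP[].
Qed.

Let A_ge0 W v : 0 <= A W v.
Proof. by rewrite !mulr_ge0 ?invr_ge0 ?(ltW kappa_gt0). Qed.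

Let A_le W v : A W v <= B.
Proof.
by rewrite ler_pM2r ?invr_gt0 // ler_pM2l // ler_nat card_nbrs_le.
Qed.

Lemma mem_avail W f u : f \in colorings W -> u \in W -> f u \in avail W f u.
Proof.
move=> fW uW; have := fW; rewrite mem_colorings -[W](setD1K uW).
by rewrite proper_on_setU1 avail_setU1 => /andP[].
Qed.

(** [sum_prod_avail_ge], averaged over the classes of colorings that differ only on
v and its neighbors. *)
Lemma card_extensions_ge W v : v \notin W ->
  \sum_(f in colorings W) expR (- A W v) * (1 - (few W v f)%:R * (1 + A W v) / q%:R)
    <= #|colorings (v |: W)|%:R.
Proof.
move=> vW; set N := nbrs W v.
have -> : #|colorings (v |: W)|%:R =
    \sum_(f in colorings W) (if f v \in avail W f v then 1 else 0) :> R.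
  rewrite -big_mkcondr -sum1_card natr_sum; apply: eq_bigl => f.
  by rewrite !mem_colorings proper_on_setU1.
apply: (ler_sum_fibers (rho := erase (v |: N))) => f0 f0W.
have -> : \sum_(f in colorings W | erase (v |: N) f == erase (v |: N) f0)
      (if f v \in avail W f v then 1 else 0)
    = (\sum_(c : 'I_q) \prod_(u in N) #|avail W f0 u :\ c|)%:R :> R.
  rewrite -(card_fiber_setU1 vW f0W) -big_mkcondr -sum1_card natr_sum.
  by apply: eq_bigl => f; rewrite in_set !mem_colorings proper_on_setU1 andbAC.
rewrite (eq_bigr (fun=> expR (- A W v) * (1 - (few W v f0)%:R * (1 + A W v) / q%:R))).
  2: {
    move=> f /andP[_ /eqP E]; congr (_ * (1 - _%:R * _ / _)); apply: eq_card => u.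
    rewrite [LHS]in_set [RHS]in_set; have [uN|//] := boolP (u \in nbrs W v).
    by rewrite (avail_resample vW _ E) // nbrs_disjoint. }
rewrite sumr_const.
rewrite (_ : #|_| = (q * \prod_(u in N) #|avail W f0 u|)%N); last first.
  by rewrite -(card_fiber vW f0W); apply: eq_card => f; rewrite in_set.
rewrite -[leLHS]mulr_natr natrM natr_prod.
set P := \prod_(u in N) _.
have L0 u : u \in N -> avail W f0 u != set0.
  rewrite in_set => /andP[uW _]; apply/set0Pn; exists (f0 u); exact: mem_avail.
have P0 : 0 <= P by apply: prodr_ge0.
have -> : (\sum_(c < q) \prod_(u in N) #|avail W f0 u :\ c|)%:R =
    P * \sum_(c : 'I_q) \prod_(u in N) (#|avail W f0 u :\ c|%:R / #|avail W f0 u|%:R).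
  rewrite mulr_sumr natr_sum; apply: eq_bigr => c _; rewrite natr_prod -big_split /=.
  apply: eq_bigr => u /L0 L0u; rewrite mulrC divfK //.
  by rewrite pnatr_eq0 cards_eq0.
apply: le_trans (ler_wpM2l P0 (sum_prod_avail_ge lam_gt0 q_gt0 L0)).
rewrite -/N -/(A W v) -/(few W v f0) le_eqVlt; apply/orP; left; apply/eqP.
by field; rewrite gt_eqF.
Qed.

(** By [card_extensions_ge] only the expected number of short lists matters.
[card_small_avail] compares it with colorings of W :\ u, and the induction
hypothesis, applied to W :\ u and u, compares these with colorings of W. *)
Lemma card_extend W v : v \notin W ->
  expR (- A W v) / 2 * #|colorings W|%:R <= #|colorings (v |: W)|%:R.
Proof.
have [m] := ubnP #|W|; elim: m W v => // m IH W v ltWm vW.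
apply: le_trans (card_extensions_ge vW).
set C := #|colorings W|%:R.
have C0 : 0 <= C by [].
have small_le u : u \in nbrs W v ->
    q%:R * #|[set f in colorings W | #|avail W f u|%:R <= 1 + lam]|%:R
      <= (1 + lam) * (2 * expR B * C).
  rewrite in_set => /andP[uW _].
  have uWu : u \notin W :\ u by rewrite !inE eqxx.
  have ltWu : (#|W :\ u| < m)%N by move: ltWm; rewrite (cardsD1 u W) uW.
  have := IH _ u ltWu uWu; rewrite setD1K // -/C => IHu.
  have -> : [set f in colorings W | #|avail W f u|%:R <= 1 + lam] =
      [set f in colorings (u |: (W :\ u)) | #|avail (W :\ u) f u|%:R <= 1 + lam].
    by apply/setP => f; rewrite !in_set -[in RHS]avail_setU1 setD1K.
  have lam1 : 0 <= 1 + lam by rewrite addr_ge0 ?(ltW lam_gt0).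
  apply: le_trans (card_small_avail uWu lam1) _; rewrite ler_wpM2l //.
  have eB : expR (- B) / 2 * #|colorings (W :\ u)|%:R <= C.
    by apply: le_trans IHu; rewrite ler_wpM2r // ler_wpM2r // ler_expR lerN2 A_le.
  rewrite -(ler_pM2l (_ : 0 < expR (- B) / 2)) ?mulr_gt0 ?expR_gt0 //.
  apply: le_trans eB _; rewrite expRN le_eqVlt; apply/orP; left; apply/eqP.
  by field; rewrite gt_eqF ?expR_gt0.
have sum_few : q%:R * \sum_(f in colorings W) (few W v f)%:R <=
    Delta%:R * ((1 + lam) * (2 * expR B * C)) :> R.
  have -> : \sum_(f in colorings W) (few W v f)%:R = \sum_(u in nbrs W v)
       #|[set f in colorings W | #|avail W f u|%:R <= 1 + lam]|%:R :> R.
    under eq_bigr => f _.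
      rewrite /few -sum1_card natr_sum.
      under eq_bigl => u do rewrite in_set.
      rewrite big_mkcondr /=.
    over.
    rewrite exchange_big /=; apply: eq_bigr => u _.
    rewrite -big_mkcondr -sum1_card natr_sum; apply: eq_bigl => f.
    by rewrite in_set.
  rewrite mulr_sumr; apply: le_trans (ler_sum _ small_le) _.
  rewrite sumr_const -[leLHS]mulr_natl ler_wpM2r ?ler_nat ?card_nbrs_le //.
  by rewrite !mulr_ge0 ?addr_ge0 ?expR_ge0 ?(ltW lam_gt0).
rewrite -mulr_sumr -mulrA ler_wpM2l ?expR_ge0 //.
rewrite sumrB -mulr_suml -mulr_suml (_ : \sum_(f in colorings W) 1 = C) ?sumr_const //.
set S := \sum_(f in _) _ in sum_few *.
rewrite -(ler_pM2l (exprn_gt0 2 qR_gt0)).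
have -> : q%:R ^+ 2 * (C - S * (1 + A W v) / q%:R) =
    q%:R ^+ 2 * C - (1 + A W v) * (q%:R * S).
  by field; rewrite gt_eqF.
have A1 : 0 <= 1 + A W v by rewrite addr_ge0.
have h1 := ler_wpM2l A1 sum_few.
have h2 : (1 + A W v) * (Delta%:R * ((1 + lam) * (2 * expR B * C))) <=
    (1 + B) * (Delta%:R * ((1 + lam) * (2 * expR B * C))).
  rewrite ler_wpM2r ?lerD2l ?A_le //.
  by rewrite !mulr_ge0 ?addr_ge0 ?expR_ge0 ?(ltW lam_gt0).
have h3 := ler_wpM2r C0 slack.
rewrite -lerN2 opprB lerBlDr; apply: le_trans (le_trans h1 h2) _.
apply: le_trans (_ : q%:R ^+ 2 * C / 2 <= _); last by lra.
by move: h3; lra.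
Qed.

(** * Adding all vertices *)

(* twice the number of edges inside U *)
Let D U := (\sum_(u in U) #|nbrs U u|)%N.

Lemma degree_sum_setU1 W v : v \notin W -> D (v |: W) = (D W + 2 * #|nbrs W v|)%N.
Proof.
move=> vW; rewrite /D big_setU1 //=.
have -> : nbrs (v |: W) v = nbrs W v.
  by apply/setP => u; rewrite !inE; have [->|] //= := eqVneq u v; rewrite adj_irrefl andbF.
have nbrsE u : u \in W -> #|nbrs (v |: W) u| = (#|nbrs W u| + adj v u)%N.
  move=> uW; rewrite addnC (cardsD1 v) !inE eqxx adj_sym; congr (_ + _)%N.
  by apply: eq_card => x; rewrite !inE; have [->|] //= := eqVneq x v; rewrite (negPf vW).
rewrite (eq_bigr _ nbrsE) big_split /= mul2n -addnn addnCA; congr (_ + (_ + _))%N.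
rewrite -big_mkcondr /= -sum1_card; apply: eq_bigl => u; by rewrite !inE.
Qed.

Lemma card_colorings_ge U :
  2^-1 ^+ #|U| * expR (- (kappa * (D U)%:R / (2 * q%:R))) * q%:R ^+ #|G|
    <= #|colorings U|%:R.
Proof.
have [m] := ubnP #|U|; elim: m U => // m IH U ltUm.
have [->|[v vU]] := set_0Vmem U.
  rewrite cards0 expr0 mul1r /D big_set0 mulr0 mul0r oppr0 expR0 mul1r.
  rewrite (_ : colorings set0 = setT) ?cardsT ?card_ffun ?card_ord ?natrX //.
  by apply/setP => f; rewrite in_setT mem_colorings; apply/proper_onP => u w; rewrite inE.
set W := U :\ v; have vW : v \notin W by rewrite !inE eqxx.
have UE : U = v |: W by rewrite setD1K.
have ltWm : (#|W| < m)%N by move: ltUm; rewrite UE cardsU1 vW.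
rewrite UE; apply: le_trans (card_extend vW).
apply: le_trans (ler_wpM2l _ (IH _ ltWm)); last by rewrite mulr_ge0 ?expR_ge0.
rewrite cardsU1 vW exprS degree_sum_setU1 //.
have -> : - (kappa * (D W + 2 * #|nbrs W v|)%:R / (2 * q%:R)) =
    - A W v - kappa * (D W)%:R / (2 * q%:R).
  by rewrite /A natrD natrM; field; rewrite gt_eqF.
by rewrite expRD le_eqVlt; apply/orP; left; apply/eqP; ring.
Qed.

Lemma num_colorings_ge :
  (q%:R / 2 * expR (- (B / 2))) ^+ #|G| <= (num_colorings G q)%:R.
Proof.
have -> : num_colorings G q = #|colorings setT|.
  apply: eq_card => f; rewrite in_set mem_colorings.
  apply/forallP/proper_onP => [H u v _ _ uv|H u].
    by have /forallP/(_ v)/implyP := H u; apply.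
  by apply/forallP => v; apply/implyP; apply: H; rewrite in_setT.
apply: le_trans (card_colorings_ge setT); rewrite cardsT.
rewrite !exprMn -expRM_natr.
have -> : 2^-1 ^+ #|G| * expR (- (kappa * (D setT)%:R / (2 * q%:R))) * q%:R ^+ #|G| =
   q%:R ^+ #|G| * 2^-1 ^+ #|G| * expR (- (kappa * (D setT)%:R / (2 * q%:R))) by ring.
rewrite ler_wpM2l ?mulr_ge0 ?exprn_ge0 ?invr_ge0 // ler_expR mulNr lerN2.
have -> : B / 2 * #|G|%:R = kappa * (#|G| * Delta)%:R / (2 * q%:R).
  by rewrite /B natrM; field; rewrite gt_eqF.
rewrite ler_wpM2r ?invr_ge0 ?mulr_ge0 // ler_wpM2l ?(ltW kappa_gt0) // ler_nat.
rewrite /D -cardsT -sum_nat_const; apply: leq_sum => u _; exact: card_nbrs_le.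
Qed.
End Colorings.

(** * Asymptotics *)

Section Asymptotics.
Local Open Scope classical_set_scope.
Variable R : realType.

Lemma ln_ge_of_truncn (M : R) (n : nat) : ((Num.truncn (expR M)).+1 <= n)%N -> M <= ln n%:R.
Proof.
move=> Mn; have lt_Mn : expR M < n%:R.
  by apply: lt_le_trans (truncnS_gt _) _; rewrite ler_nat.
rewrite -[M]expRK ler_ln ?posrE ?expR_gt0 ?(ltW lt_Mn) //.
exact: lt_trans (expR_gt0 M) lt_Mn.
Qed.

Lemma error_cvg0 : (fun n : nat => 4 / Num.sqrt (ln (n%:R : R))) @ \oo --> (0 : R).
Proof.
apply/cvgrPdist_lt => e e0.
exists (Num.truncn (expR ((4 / e) ^+ 2 + 1))).+1 => // n /= /ln_ge_of_truncn ln_n.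
have e4 : 0 < 4 / e by rewrite divr_gt0.
have ln_gt : (4 / e) ^+ 2 < ln (n%:R : R) by apply: lt_le_trans ln_n; rewrite ltrDl.
have sq : 4 / e < Num.sqrt (ln (n%:R : R)).
  rewrite -(gtr0_norm e4) -sqrtr_sqr ltr_sqrt //.
  by apply: lt_trans ln_gt; rewrite exprn_gt0.
have sq0 := lt_trans e4 sq.
rewrite sub0r normrN gtr0_norm ?divr_gt0 // ltr_pdivrMr // mulrC.
by rewrite -ltr_pdivrMr.
Qed.

Variable eps : R.
Hypothesis eps_gt0 : 0 < eps.
Let sigma := (1 + eps)^-1.

(** A lower bound on ln Delta that makes exp((1 - sigma) L) exceed 64 L ^ 4 for all
larger L, by the inequality exp(x) >= x with x = (1 - sigma) L / 5 raised to the
fifth power; the 2 ensures that lower order terms are absorbed. *)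
Definition threshold : R := 2 + 64 * (5 / (1 - sigma)) ^+ 5.

Let sigma01 : 0 < sigma < 1.
Proof. by rewrite invr_gt0 invf_lt1 ?ltrDl ?eps_gt0 ?addr_gt0. Qed.

Let epsE : eps / (1 + eps) = 1 - sigma.
Proof. by rewrite /sigma; field; rewrite gt_eqF // addr_gt0. Qed.

(* L stands for ln Delta, and expR L for Delta *)
Variables (L q : R).
Hypothesis L_ge : threshold <= L.
Hypothesis q_ge : (1 + eps) * expR L / L <= q.
Let B := (1 + L^-1) * expR L / q.

Let L_ge2 : 2 <= L.
Proof.
apply: le_trans L_ge; rewrite lerDl mulr_ge0 // exprn_ge0 // divr_ge0 //.
by rewrite subr_ge0 ltW //; case/andP: sigma01.
Qed.

Let L_gt0 : 0 < L. Proof. exact: lt_le_trans L_ge2. Qed.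

Lemma q_ge_expR_div : expR L / L <= q.
Proof.
apply: le_trans q_ge; rewrite ler_wpM2r ?invr_ge0 ?(ltW L_gt0) //.
by rewrite ler_peMl ?expR_ge0 // lerDl ltW.
Qed.

Let q_gt0 : 0 < q.
Proof. by apply: lt_le_trans q_ge_expR_div; rewrite divr_gt0 ?expR_gt0. Qed.

Lemma B_le : B <= sigma * (L + 1).
Proof.
rewrite ler_pdivrMr //; apply: le_trans (ler_wpM2l _ q_ge); last first.
  by rewrite mulr_ge0 ?addr_ge0 ?(ltW L_gt0) // ltW //; case/andP: sigma01.
rewrite le_eqVlt; apply/orP; left; apply/eqP; rewrite /sigma.
by field; rewrite !gt_eqF // addr_gt0.
Qed.

(** Up to powers of L the left side is at most exp(L + sigma L) and the right side at
least exp(2 L), where sigma < 1. *)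
Lemma slack_ok : 4 * (1 + B) * expR L * (1 + L) * expR B <= q ^+ 2.
Proof.
have /andP[s0 s1] := sigma01.
have B0 : 0 <= B by rewrite !mulr_ge0 ?addr_ge0 ?invr_ge0 ?expR_ge0 ?(ltW L_gt0) ?(ltW q_gt0).
have BL : B <= L + 1 by apply: le_trans B_le _; move: L_gt0; nra.
have expL0 := expR_gt0 L.
have d0 : 0 < 1 - sigma by rewrite subr_gt0.
have growth : 64 * L ^+ 4 <= expR ((1 - sigma) * L).
  have -> : (1 - sigma) * L = ((1 - sigma) * L / 5) * 5%:R by field.
  rewrite expRM_natr; set x := (1 - sigma) * L / 5.
  have x0 : 0 <= x by rewrite divr_ge0 // mulr_ge0 // ltW.
  have : x ^+ 5 <= expR x ^+ 5.
    rewrite lerXn2r ?nnegrE ?expR_ge0 //.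
    by apply: le_trans (expR_ge1Dx x); rewrite lerDr.
  apply: le_trans.
  have -> : x ^+ 5 = L / (5 / (1 - sigma)) ^+ 5 * L ^+ 4.
    by rewrite /x; field; rewrite gt_eqF.
  rewrite ler_wpM2r ?exprn_ge0 ?(ltW L_gt0) // ler_pdivlMr ?exprn_gt0 ?divr_gt0 //.
  by apply: le_trans L_ge; rewrite /threshold lerDr.
have exp_sigma : expR sigma <= 4.
  have -> : sigma = sigma / 2 * 2%:R by field.
  rewrite expRM_natr -[4](_ : 2 ^+ 2 = 4 :> R); last by ring.
  rewrite lerXn2r ?nnegrE ?expR_ge0 //.
  rewrite -[leLHS]invrK -expRN invf_ple ?posrE ?expR_gt0 //.
  by apply: le_trans (expR_ge1Dx _); lra.
have expB : expR B <= 4 * expR L / expR ((1 - sigma) * L).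
  have -> : 4 * expR L / expR ((1 - sigma) * L) = 4 * expR (sigma * L).
    by rewrite -mulrA -expRN -expRD; congr (_ * expR _); ring.
  apply: le_trans (_ : expR (sigma * (L + 1)) <= _); first by rewrite ler_expR B_le.
  by rewrite mulrDr mulr1 addrC expRD ler_wpM2r ?expR_ge0.
have qsq : (expR L / L) ^+ 2 <= q ^+ 2.
  rewrite lerXn2r ?nnegrE ?(ltW q_gt0) ?q_ge_expR_div //.
  by rewrite divr_ge0 ?(ltW L_gt0) ?expR_ge0.
apply: le_trans qsq.
apply: (@le_trans _ _ (4 * (L + 2) * expR L * (1 + L) * (4 * expR L / (64 * L ^+ 4)))).
  apply: ler_pM; rewrite ?expR_ge0 ?mulr_ge0 ?addr_ge0 ?expR_ge0 ?(ltW L_gt0) //.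
    rewrite ler_wpM2r ?addr_ge0 ?(ltW L_gt0) // ler_wpM2r ?expR_ge0 // ler_wpM2l //.
    by move: BL; lra.
  apply: le_trans expB _; rewrite ler_wpM2l ?mulr_ge0 ?expR_ge0 //.
  by rewrite lef_pV2 ?posrE ?expR_gt0 ?mulr_gt0 ?exprn_gt0.
have -> : 4 * (L + 2) * expR L * (1 + L) * (4 * expR L / (64 * L ^+ 4)) =
    (expR L / L) ^+ 2 * ((L + 2) * (1 + L) / (4 * L ^+ 2)).
  by field; rewrite gt_eqF.
rewrite ler_piMr ?exprn_ge0 ?divr_ge0 ?expR_ge0 ?(ltW L_gt0) //.
rewrite ler_pdivrMr ?mulr_gt0 ?exprn_gt0 // mul1r.
by move: L_ge2; nra.
Qed.

(** The loss in the exponent against L - sigma L / 2 is ln L + ln 2 + sigma / 2: from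
q >= exp(L) / L, from the factor 1/2, and from kappa = 1 + 1/L.  It is
below 2 sqrt L because ln L = 2 ln (sqrt L) <= 2 (sqrt L - 1). *)
Lemma per_vertex_ge :
  expR ((1 + eps / (1 + eps) - 4 / Num.sqrt L) * (L / 2)) <= q / 2 * expR (- (B / 2)).
Proof.
have /andP[s0 s1] := sigma01.
have sqL0 : 0 < Num.sqrt L by rewrite sqrtr_gt0.
have LE : L = Num.sqrt L ^+ 2 by rewrite sqr_sqrtr // ltW.
have lnL : ln L <= 2 * (Num.sqrt L - 1).
  have -> : ln L = 2 * ln (Num.sqrt L) by rewrite {1}LE lnXn // mulr_natl.
  rewrite ler_wpM2l //.
  have := @le_ln1Dx R (Num.sqrt L - 1); rewrite (addrC 1) subrK; apply.
  by rewrite ltrBrDr addNr.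
have ln2 : ln 2 <= 1 :> R.
  have := @le_ln1Dx R 1; apply; lra.
have q2 : expR (L - ln L - ln 2) <= q / 2.
  rewrite !expRD !expRN !lnK ?posrE // ler_pM2r ?invr_gt0 //.
  exact: q_ge_expR_div.
apply: (@le_trans _ _ (expR (L - ln L - ln 2) * expR (- (B / 2)))); last first.
  by rewrite ler_wpM2r ?expR_ge0.
rewrite -expRD ler_expR.
have -> : (1 + eps / (1 + eps) - 4 / Num.sqrt L) * (L / 2) =
    L - sigma * L / 2 - 2 * Num.sqrt L.
  rewrite epsE; move: (Num.sqrt L) LE sqL0 => x -> x0.
  by field; rewrite gt_eqF.
by have := B_le; move: lnL ln2 s1; lra.
Qed.
End Asymptotics.

Local Open Scope classical_set_scope.

Theorem corollary1p4 (R : realType) (eps : R) (eps_gt0 : 0 < eps) :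
  exists (Delta0 : nat) (r : nat -> R),
    r @ \oo --> (0 : R) /\
    forall (Delta : nat) (G : sgraph) (q : nat),
      (Delta0 <= Delta)%N ->
      triangle_free G ->
      (max_degree G <= Delta)%N ->
      (1 + eps) * Delta%:R / ln (Delta%:R : R) <= q%:R ->
      expR ((1 + eps / (1 + eps) - r Delta) * (ln (Delta%:R : R) / 2) * #|G|%:R)
        <= (num_colorings G q)%:R.
Proof.
exists (Num.truncn (expR (threshold eps))).+1, (fun n => 4 / Num.sqrt (ln (n%:R : R))).
split; first exact: error_cvg0.
move=> Delta G q leD triG degG q_ge.
have L_ge := ln_ge_of_truncn leD.
have D_gt0 : 0 < Delta%:R :> R by rewrite ltr0n (leq_trans _ leD).
set L := ln (Delta%:R : R) in L_ge q_ge *.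
have DE : Delta%:R = expR L by rewrite lnK.
rewrite DE in q_ge.
have L_gt0 : 0 < L.
  apply: lt_le_trans L_ge; apply: ltr_pwDl => //.
  rewrite mulr_ge0 // exprn_ge0 // divr_ge0 // subr_ge0 invf_le1 ?addr_gt0 //.
  by rewrite lerDl ltW.
have q_gt0 : (0 < q)%N.
  by rewrite -(ltr0n R) (lt_le_trans _ q_ge) // !mulr_gt0 ?invr_gt0 ?expR_gt0 ?addr_gt0.
have slack := slack_ok eps_gt0 L_ge q_ge.
rewrite expRM_natr.
apply: le_trans (num_colorings_ge triG degG q_gt0 L_gt0 _); rewrite DE //.
rewrite lerXn2r ?nnegrE ?expR_ge0 ?mulr_ge0 ?expR_ge0 ?invr_ge0 //.
exact: per_vertex_ge.
Qed.
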